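(* Let $L$ be a virtual singular link with $k$ components, and let $D$ be any oriented diagram of $L$. Then $R(L)=R(D)=\phi(D)h+\psi(D)$ with $\phi(D)\in\mathbb{Z}[A^4,A^{-4}]\cdot A^{2(k-1)}$ and $\psi(D)\in\mathbb{Z}[A^4,A^{-4}]\cdot A^{2k}$.
   Context: An oriented virtual singular link diagram is a generic immersion of finitely many oriented circles (its components) into $\mathbb{R}^2$ with finitely many transverse double points, each decorated as a classical crossing (with over/under information and the usual sign $\pm1$), a singular crossing, or a virtual crossing; a virtual singular link is an equivalence class of such diagrams under planar isotopy and the extended Reidemeister moves (classical $R_1,R_2,R_3$; sliding a strand entirely over/under a singular crossing; moving a classical crossing between the same two strands to the other side of a singular crossing; virtual $V_1,V_2,V_{3}$; sliding a strand with two consecutive virtual crossings across a classical or a singular crossing). At a classical or singular crossing, the oriented resolution replaces it by two disjoint arcs respecting orientation; the disoriented resolution replaces it by one arc joining the two incoming ends with a sink bivalent vertex and one arc joining the two outgoing ends with a source bivalent vertex. Virtual crossings are kept. A state $S$ of $D$ is a choice of resolution at every classical and singular crossing; it is a collection of immersed closed curves (all intersections virtual) carrying bivalent vertices with edge orientations alternating. $\|S\|$ = number of closed curves; $c(D)$ = number of classical crossings; $a(S)$ = #(negative classical crossings with oriented resolution) $-$ #(positive classical crossings with oriented resolution); $b(S)$ the same for disoriented resolutions; $\alpha(S),\beta(S)$ = numbers of singular crossings with oriented, resp. disoriented, resolution. An edge of $S$ is an arc between consecutive bivalent vertices (a closed curve without vertices is one edge). A weight map is $\tau:E(S)\to\{\pm1\}$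 with different values on edges sharing a vertex; for a virtual crossing $v$ where edges $e,e'$ meet (possibly $e=e'$), $i_\tau(v)=\tau(e)\tau(e')$, and $i(S)=\prod_v i_\tau(v)$ (independent of $\tau$). Let $\overline{R}(S)=A^{2a(S)+4b(S)}(-A^2-A^{-2})^{\alpha(S)+\|S\|}(-A^4-A^{-4})^{\beta(S)}$, $R(D)=(-1)^{c(D)}\sum_S\overline{R}(S)h^{\frac{1-i(S)}{2}}$, $\phi(D)=(-1)^{c(D)}\sum_{S:\,i(S)=-1}\overline{R}(S)$, $\psi(D)=(-1)^{c(D)}\sum_{S:\,i(S)=1}\overline{R}(S)$. $R(D)$ depends only on the link $L$ represented by $D$, and $R(L):=R(D)$. *)

(* Defs.v *)
From HB Require Import structures.
From mathcomp Require Import all_boot all_order all_algebra.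
From mathcomp Require Import fraction.
Set Implicit Arguments. Unset Strict Implicit. Unset Printing Implicit Defensive.
Import Order.TTheory GRing.Theory Num.Theory.
Local Open Scope ring_scope.

(* Combinatorial model of an oriented virtual singular link diagram.        *)
(* The crossings (classical, singular and virtual double points) are the    *)
(* vertices 'I_nv of a 4-valent graph.  Half-edges ("darts") are pairs      *)
(* (v, j) with j : 'I_4 the position of the half-edge in the cyclic         *)
(* (counterclockwise) order around v; (v,j) and (v,j+2) are opposite, i.e.  *)
(* belong to the same strand through v (transversality).  [glue] pairs the  *)
(* two half-edges of every edge; [outd d] says that the strand leaves the   *)
(* crossing along d.  The rotation system (rotation j |-> j+1, gluing) must *)
(* have genus 0 (Euler formula on every connected component), which is      *)
(* exactly the condition that the curve is a generic immersion in the plane.*)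
(* [nfree] is the number of components that carry no double point.         *)

Inductive xtype := Classical of bool (* sign: true = +1, false = -1 *)
                 | Singular | Virtual.

Definition is_virtual (x : xtype) := if x is Virtual then true else false.
Definition is_singular (x : xtype) := if x is Singular then true else false.
Definition is_classical (x : xtype) := if x is Classical _ then true else false.
Definition is_classical_sign (b : bool) (x : xtype) :=
  if x is Classical b' then b' == b else false.

Definition dart (n : nat) := ('I_n * 'I_4)%type.

Definition drot n (d : dart n) : dart n := (d.1, d.2 + 1).
Definition drotV n (d : dart n) : dart n := (d.1, d.2 - 1).
Definition dopp n (d : dart n) : dart n := (d.1, d.2 + 1 + 1).

Record diagram := Diagram {
  nv : nat;
  xkind : 'I_nv -> xtype;
  glue : dart nv -> dart nv;
  outd : dart nv -> bool;
  nfree : nat }.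
Arguments xkind : clear implicits.
Arguments glue : clear implicits.
Arguments outd : clear implicits.

Definition nfaces (D : diagram) :=
  n_comp (frel (fun d : dart (nv D) => drot (glue D d))) predT.
Definition ngraphcomp (D : diagram) :=
  n_comp (fun x y : dart (nv D) => (y == drot x) || (y == glue D x)) predT.

Definition wf_diagram (D : diagram) : Prop :=
  [/\ forall d, glue D (glue D d) = d,
      forall d, glue D d != d,
      forall d, outd D (dopp d) = ~~ outd D d,
      forall d, outd D (glue D d) = ~~ outd D d &
      (* genus 0 : V - E + F = 2 C with E = 2 V *)
      nfaces D = (nv D + 2 * ngraphcomp D)%N ].

Definition snext (D : diagram) (d : dart (nv D)) : dart (nv D) := dopp (glue D d).

Definition ncomponents (D : diagram) : nat :=
  (n_comp (frel (@snext D)) [pred d | outd D d] + nfree D)%N.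

Definition ncl (D : diagram) : nat := #|[pred v | is_classical (xkind D v)]|.

(* States.  s v = true : oriented resolution at v, false : disoriented.     *)
(* Values of s at virtual crossings are irrelevant and fixed to true.       *)
Definition state (D : diagram) := {ffun 'I_(nv D) -> bool}.

Definition is_state (D : diagram) (s : state D) :=
  [forall v, is_virtual (xkind D v) ==> s v].

(* the half-edge joined to d inside the (resolved) crossing *)
Definition partner (D : diagram) (s : state D) (d : dart (nv D)) : dart (nv D) :=
  if is_virtual (xkind D d.1) then dopp d
  else let same := outd D (drot d) == outd D d in
       if s d.1 then (if same then drotV d else drot d)
       else (if same then drot d else drotV d).

Definition ncurves (D : diagram) (s : state D) : nat :=
  (n_comp (fun x y : dart (nv D) => (y == glue D x) || (y == partner s x)) predT
   + nfree D)%N.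

(* weight maps, recorded on half-edges: constant along an edge (through     *)
(* virtual crossings and oriented resolutions), switching at bivalent        *)
(* vertices (disoriented resolutions).                                       *)
Definition is_weight (D : diagram) (s : state D) (tau : {ffun dart (nv D) -> bool}) :=
  [forall d, (tau (glue D d) == tau d) &&
             (tau (partner s d) ==
                (tau d (+) (~~ is_virtual (xkind D d.1) && ~~ s d.1)))].

Definition bsign (b : bool) : int := if b then 1 else -1.

Definition ival (D : diagram) (tau : {ffun dart (nv D) -> bool}) : int :=
  \prod_(v | is_virtual (xkind D v))
     (bsign (tau (v, 0 : 'I_4)) * bsign (tau (v, 1 : 'I_4))).

(* i(S), computed with some weight map (it is independent of the choice) *)
Definition iS (D : diagram) (s : state D) : int :=
  if [pick tau | is_weight s tau] is Some tau then ival tau else 1.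

Definition a_st (D : diagram) (s : state D) : int :=
  #|[pred v | is_classical_sign false (xkind D v) && s v]|%:Z
  - #|[pred v | is_classical_sign true (xkind D v) && s v]|%:Z.
Definition b_st (D : diagram) (s : state D) : int :=
  #|[pred v | is_classical_sign false (xkind D v) && ~~ s v]|%:Z
  - #|[pred v | is_classical_sign true (xkind D v) && ~~ s v]|%:Z.
Definition alpha_st (D : diagram) (s : state D) : nat :=
  #|[pred v | is_singular (xkind D v) && s v]|.
Definition beta_st (D : diagram) (s : state D) : nat :=
  #|[pred v | is_singular (xkind D v) && ~~ s v]|.

(* Laurent polynomials Z[A, A^-1] inside the fraction field Q(A).            *)
Definition LK := {fraction {poly int}}.
Definition varA : LK := FracField.tofrac ('X : {poly int}).

Definition Rbar (D : diagram) (s : state D) : LK :=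
  varA ^ (2 * a_st s + 4 * b_st s)
  * (- varA ^+ 2 - varA ^- 2) ^+ (alpha_st s + ncurves s)
  * (- varA ^+ 4 - varA ^- 4) ^+ beta_st s.

Definition phi (D : diagram) : LK :=
  (-1) ^+ ncl D * \sum_(s : state D | is_state s && (iS s == -1)) Rbar s.
Definition psi (D : diagram) : LK :=
  (-1) ^+ ncl D * \sum_(s : state D | is_state s && (iS s == 1)) Rbar s.

(* R(D) as a polynomial in h with coefficients in Z[A,A^-1]; h^((1-i)/2) *)
Definition Rpoly (D : diagram) : {poly LK} :=
  (-1) ^+ ncl D *: \sum_(s : state D | is_state s)
     Rbar s *: 'X ^+ (if iS s == 1 then 0%N else 1%N).

Definition in_Z4_coset (x : LK) (r : int) : Prop :=
  exists (p : {poly int}) (m : nat),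
    x = varA ^ r * varA ^- (4 * m) * FracField.tofrac (p \Po 'X^4).

(* Main.v *)
From HB Require Import structures.
Require Import Defs.
From mathcomp Require Import all_boot all_order all_algebra all_fingroup.
From mathcomp Require Import fraction zify ring.
Set Implicit Arguments. Unset Strict Implicit. Unset Printing Implicit Defensive.
Import Order.TTheory GRing.Theory Num.Theory.
Local Open Scope ring_scope.

(* Every factor of Rbar(S) lies in A^(2j) Z[A^4,A^-4] for a suitable j, so
   everything reduces to the congruence
     (-1)^(||S|| + k + o(S)) = i(S),
   o(S) being the number of crossings with the oriented resolution.
   A weight map tau amounts to an orientation [w] of the curves of S, tau
   recording where [w] agrees with the orientation of D.  Cycles of the
   diagram and of the state are orbits of permutations of the outgoing
   half-edges, so ||S|| + k modulo 2 is a product of signs, which can be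
   computed locally: reversing the edges of T = {tau = 1}, exchanging two
   half-edges at each resolved crossing, and reversing the arcs inside the
   crossings.  Summing these signs leaves i(S), o(S) and the number of
   vertices where T and its complement cross transversally.  T and its
   complement are mod 2 cycles, and two such cycles in the plane cross an even
   number of times: genus 0 makes T the boundary of a 2-colouring of the faces,
   whose colour changes along the complement of T exactly at the crossings. *)

(** * Counting connected components: by invariant functions and by labels *)

Lemma connect_invariant (T : finType) (S : Type) (e : rel T) (f : T -> S) x y :
  (forall x y, e x y -> f x = f y) -> connect e x y -> f x = f y.
Proof.
move=> fe /connectP[p]; elim: p x => [|z p IHp] x /=; first by move=> _ ->.
by move=> /andP[/fe -> /IHp].
Qed.

(** An invariant function is given by arbitrary values at the component roots, so [J] maps the
    functions on roots isomorphically onto [U]. *)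
Lemma dim_invariants (K : fieldType) (T : finType) (e : rel T)
    (U : {vspace {ffun T -> K^o}}) :
    connect_sym e ->
    (forall f : {ffun T -> K^o},
       reflect (forall x y, e x y -> f x = f y) (f \in U)) ->
  \dim U = n_comp e predT.
Proof.
move=> sym_e U_P; pose r := {x : T | roots e x}.
pose toR x : r := exist _ (fingraph.root e x) (roots_root sym_e x).
pose J (g : {ffun r -> K^o}) : {ffun T -> K^o} := [ffun x => g (toR x)].
have J_lin : linear J by move=> a u v; apply/ffunP=> x; rewrite !ffunE.
pose JL := GRing.isLinear.Build _ _ _ _ J J_lin.
pose Jl : {linear {ffun r -> K^o} -> {ffun T -> K^o}} := HB.pack J JL.
have toR_val (z : r) : toR (val z) = z.
  by apply: val_inj => /=; apply/eqP; exact: (valP z).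
have ker0 : lker (linfun Jl) == 0%VS.
  apply/lker0P => u v; rewrite !lfunE /= => /ffunP uv.
  by apply/ffunP => z; have := uv (val z); rewrite !ffunE toR_val.
have <- : limg (linfun Jl) = U.
  apply/vspaceP => f; apply/memv_imgP/U_P => [[g _ ->] x y exy|fP].
    rewrite !lfunE /= !ffunE; congr (g _); apply: val_inj => /=.
    exact/(fingraph.rootP sym_e)/connect1.
  exists [ffun z : r => f (val z)]; first exact: memvf.
  rewrite !lfunE /=; apply/ffunP => x; rewrite !ffunE /=.
  by apply: connect_invariant fP _; apply: connect_root.
rewrite limg_dim_eq; last by rewrite (eqP ker0) capv0.
rewrite dimvf /dim /= muln1 card_sig /n_comp_mem.
by apply: eq_card => x; rewrite !inE andbT.
Qed.

Lemma n_comp_image (T S : finType) (e : rel T) (a : {pred T}) (cls : T -> S) :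
    connect_sym e -> closed e a ->
    {in a &, forall x y, (cls x == cls y) = connect e x y} ->
  n_comp e a = #|[set cls x | x in a]|.
Proof.
move=> sym_e cl_a clsP.
have -> : [set cls x | x in a] = [set cls x | x in predI (roots e) a].
  apply/eqP; rewrite eqEsubset; apply/andP; split; last first.
    by apply: imsetS; apply/subsetP => x; rewrite inE => /andP[].
  apply/subsetP => _ /imsetP[x ax ->]; have cx := connect_root e x.
  have ar : fingraph.root e x \in a by rewrite -(closed_connect cl_a cx).
  apply/imsetP; exists (fingraph.root e x).
    by apply/andP; split => /=; [exact: roots_root | exact: ar].
  by apply/eqP; rewrite clsP.
rewrite card_in_imset // => x y; rewrite !inE => /andP[/eqP rx ax] /andP[/eqP ry ay].
by move=> /eqP; rewrite clsP // => /(fingraph.rootP sym_e); rewrite rx ry.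
Qed.

(** * Signs of permutations and alternating circuits *)

Lemma porbit_fconnect (T : finType) (s : {perm T}) x y :
  (porbit s x == porbit s y) = fconnect s x y.
Proof.
rewrite eq_porbit_mem porbit_sym; apply/porbitP/idP => [[i ->]|xy].
  by rewrite permX fconnect_iter.
by exists (findex s x y); rewrite permX iter_findex.
Qed.

Lemma card_porbits (T : finType) (s : {perm T}) : #|porbits s| = n_comp (frel s) predT.
Proof.
rewrite (@n_comp_image _ _ _ _ (porbit s)) //.
- exact/fconnect_sym/perm_inj.
- by move=> x y _ _; apply: porbit_fconnect.
Qed.

(** The sign is the parity of the number of points minus the number of orbits. Since [c] selects one
    point of each 2-cycle, labelling each orbit by a point outside [N] shows that this difference is
    [#|N|]. *)
Lemma odd_involution (T : finType) (s : {perm T}) (c : pred T) :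
    involutive s -> (forall x, s x != x -> c (s x) = ~~ c x) ->
  odd_perm s = odd #|[pred x | (s x != x) && c x]|.
Proof.
move=> sK cs; rewrite /odd_perm card_porbits.
pose N := [pred x | (s x != x) && ~~ c x].
pose cls x := if x \in N then s x else x.
have clsE x y : (cls x == cls y) = fconnect s x y.
  have cE z : fconnect s z (cls z).
    by rewrite /cls; case: ifP => // _; exact: fconnect1.
  have sym := fconnect_sym (@perm_inj _ s).
  apply/eqP/idP => [exy|].
    by apply: connect_trans (cE x) _; rewrite exy sym.
  apply: connect_invariant => {}x _ /eqP <-; rewrite /cls !inE sK (eq_sym x).
  by case: (eqVneq (s x) x) => [->//|sx] /=; rewrite cs //; case: (c x).
rewrite (@n_comp_image _ _ _ _ cls) //; last exact/fconnect_sym/perm_inj.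
have -> : #|[set cls x | x in predT]| = #|[predC N]|.
  apply: eq_card => x; rewrite !inE; apply/imsetP/idP => [[y _ ->]|xN].
    rewrite /cls; case: ifP => [/andP[sy cy]|/negbT //].
    by rewrite sK eq_sym sy cs // cy.
  by exists x => //; rewrite /cls inE (negbTE xN).
have -> : #|[pred x | (s x != x) && c x]| = #|N|.
  rewrite -(card_image (@perm_inj _ s) N); apply: eq_card => x; rewrite !inE.
  apply/andP/imageP => [[sx cx]|[y /andP[sy cy] ->]].
    by exists (s x); rewrite ?sK // !inE sK eq_sym sx cs ?cx.
  by rewrite sK eq_sym sy cs.
by rewrite -(cardC N) oddD addbK.
Qed.

Lemma card_flip (T : finType) (g : T -> T) (c : pred T) :
    involutive g -> (forall x, c (g x) = ~~ c x) ->
  #|[predC c]| = #|c|.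
Proof.
move=> gK cg; rewrite -[RHS](card_image (inv_inj gK)); apply: eq_card => x.
rewrite !inE; apply/idP/imageP => [nx|[y cy ->]].
  by exists (g x); rewrite ?gK // unfold_in cg.
by rewrite unfold_in cg negbK.
Qed.

Lemma involutive_connect_sym (T : finType) (g q : T -> T) :
    involutive g -> involutive q ->
  connect_sym (fun x y => (y == g x) || (y == q x)).
Proof.
move=> gK qK; set e := fun _ _ => _.
have e_sym x y : e x y = e y x.
  by rewrite /e -(inv_eq gK) -(inv_eq qK) !(eq_sym x).
exact: sym_connect_sym.
Qed.

Section Circuits.
Variable T : finType.

(* [g] and [q] are perfect matchings, both bipartite for [c]; on [c] this
   permutation runs through their alternating circuits. *)
Definition circuit_fun (g q : T -> T) (c : pred T) x := if c x then q (g x) else x.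

Variables (g q : T -> T) (c : pred T).
Hypotheses (gK : involutive g) (qK : involutive q).
Hypotheses (cg : forall x, c (g x) = ~~ c x) (cq : forall x, c (q x) = ~~ c x).

Lemma circuit_inj : injective (circuit_fun g q c).
Proof.
move=> x y; rewrite /circuit_fun; case cx: (c x); case cy: (c y) => //.
- by move/(inv_inj qK)/(inv_inj gK).
- by move=> E; move: cy; rewrite -E cq cg cx.
- by move=> E; move: cx; rewrite E cq cg cy.
Qed.

Definition circuit : {perm T} := perm circuit_inj.

Hypothesis even_c : ~~ odd #|c|.

(** Outside [c] the circuit permutation is the identity, giving as many singleton orbits as [c] has
    points. This number and [#|T|] are both even, so only the orbits inside [c] matter. *)
Lemma odd_circuit_fconnect : odd_perm circuit = odd (n_comp (frel (q \o g)) c).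
Proof.
rewrite /odd_perm card_porbits (n_compC c).
have cardNc : #|[predC c]| = #|c| by apply: card_flip gK cg.
have circuit_sym := fconnect_sym (@perm_inj _ circuit).
have qg_sym := fconnect_sym (inj_comp (inv_inj qK) (inv_inj gK)).
have cl_c : closed (frel circuit) c.
  move=> x y /= /eqP <-; rewrite permE /circuit_fun /in_mem /=.
  by case cx: (c x); rewrite ?cq ?cg ?cx.
have -> : n_comp (frel circuit) [predC c] = #|[predC c]|.
  rewrite (@n_comp_image _ _ _ _ id) //.
    by apply: eq_card => x; apply/imsetP/idP => [[y ? ->]|]; last exists x.
    by move=> x y /cl_c xy; exact: (congr1 negb xy).
  move=> x y ncx _; apply/eqP/idP => [->//|/iter_findex <-].
  elim: (findex _ _ _) => //= k <-; rewrite permE /circuit_fun.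
  by have /negbTE h : ~~ c x := ncx; rewrite h.
have -> : odd #|T| = false.
  by rewrite -(cardC c) [X in (_ + X)%N]cardNc addnn odd_double.
rewrite oddD cardNc (negbTE even_c) addbF /=.
congr odd; rewrite (@n_comp_image _ _ _ _ (porbit circuit)) //; last first.
  by move=> x y _ _; apply: porbit_fconnect.
apply/esym/n_comp_image => //.
  by move=> x y /= /eqP <-; rewrite /in_mem /= cq cg negbK.
move=> x y cx cy; rewrite porbit_fconnect.
have it k : iter k circuit x = iter k (q \o g) x /\ c (iter k circuit x).
  elim: k => //= k [<- ck]; rewrite permE /circuit_fun ck.
  by rewrite cq cg ck.
apply/idP/idP => /iter_findex <-; first by rewrite (it _).1 fconnect_iter.
by rewrite -(it _).1 fconnect_iter.
Qed.

(** An alternating circuit meets [c] in exactly one orbit of [q \o g]; [pos] moves a point into [c]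
    without leaving its circuit. *)
Lemma odd_circuit_connect :
  odd_perm circuit = odd (n_comp (fun x y => (y == g x) || (y == q x)) predT).
Proof.
rewrite odd_circuit_fconnect; congr odd.
have qg_sym := fconnect_sym (inj_comp (inv_inj qK) (inv_inj gK)).
pose qg : {perm T} := perm (inj_comp (inv_inj qK) (inv_inj gK)).
have qgE x y : (porbit qg x == porbit qg y) = fconnect (q \o g) x y.
  rewrite porbit_fconnect; apply: eq_fconnect => z; exact: permE.
pose pos x := if c x then x else g x.
rewrite (@n_comp_image _ _ _ _ (porbit qg)) //; last first.
  by move=> x y /= /eqP <-; rewrite /in_mem /= cq cg negbK.
rewrite (@n_comp_image _ _ _ predT (fun x => porbit qg (pos x))) //; first last.
- move=> x y _ _; rewrite qgE; set e := fun _ _ => _.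
  have posE z : connect e z (pos z).
    by rewrite /pos; case: ifP => _; [exact: connect0 | apply: connect1; rewrite /e eqxx].
  have e_sym : connect_sym e by apply: involutive_connect_sym.
  apply/idP/idP => [|exy].
    have sub : subrel (frel (q \o g)) (connect e).
      move=> u v /= /eqP <-; apply: (@connect_trans _ _ (g u));
        by apply: connect1; rewrite /e eqxx ?orbT.
    move/(connect_sub sub) => h; apply: connect_trans (posE x) _.
    by apply: connect_trans h _; rewrite e_sym.
  rewrite -qgE; apply/eqP.
  apply: (connect_invariant (f := fun x => porbit qg (pos x))) exy => {}x {}y exy.
  apply/eqP; rewrite qgE /pos; case/orP: exy => /eqP ->.
    by rewrite cg; case: (c x) => //=; rewrite ?gK.
  rewrite cq; case: (c x) => /=; last first.
    rewrite -{2}(gK x); exact: fconnect1.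
  rewrite qg_sym -{2}(qK x) -{2}(gK (q x)); exact: fconnect1.
- exact: involutive_connect_sym.
apply: eq_card => A; apply/imsetP/imsetP => [[x cx ->]|[x _ ->]].
  by exists x => //; have {}cx : c x := cx; rewrite /pos cx.
by exists (pos x) => //; rewrite /pos /in_mem /=; case cx: (c x); rewrite ?cg cx.
Qed.

End Circuits.

(* If [rho] carries (g, o) to (g, w) and [lam] carries (p, o) to (q, w), then
   [rho^-1 lam] preserves [o]; its restrictions to [o] and to the complement
   turn the circuits of (g, p) into conjugates of those of (g, q). *)
Lemma odd_circuit_transport (T : finType) (g p q : T -> T) (o w : pred T)
    (pK : involutive p) (gK : involutive g) (qK : involutive q)
    (og : forall x, o (g x) = ~~ o x) (op : forall x, o (p x) = ~~ o x)
    (wg : forall x, w (g x) = ~~ w x) (wq : forall x, w (q x) = ~~ w x)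
    (rho lam : {perm T}) :
    (forall x, rho (g x) = g (rho x)) -> (forall x, w (rho x) = o x) ->
    (forall x, lam (p x) = q (lam x)) -> (forall x, w (lam x) = o x) ->
  odd_perm (circuit gK qK wg wq)
    = odd_perm (circuit gK pK og op) (+) odd_perm rho (+) odd_perm lam.
Proof.
move=> rho_g w_rho lam_p w_lam.
have [mu mu_def] : exists mu : {perm T}, mu = (lam * rho^-1)%g by eexists.
have rho_mu x : rho (mu x) = lam x by rewrite mu_def permM permKV.
have o_mu x : o (mu x) = o x by rewrite -w_rho rho_mu w_lam.
have part_inj (b : bool) : injective (fun x => if o x == b then mu x else x).
  move=> x y; case: eqP => ox; case: eqP => oy; [exact: perm_inj|move=> E|move=> E|by []].
    by case: oy; rewrite -E o_mu.
  by case: ox; rewrite E o_mu.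
pose mu_ b := perm (part_inj b).
have muE : mu = (mu_ true * mu_ false)%g.
  apply/permP => x; rewrite permM !permE.
  by case ox: (o x); rewrite ?o_mu ox.
pose pp := perm (inv_inj pK).
(* For [x] in [o], put [e = mu^-1 (g x)]. Then [rho (g x) = lam e], and [q] sends this to
   [lam (p e) = rho (mu (p e))]. The right-hand side goes from [p (g x)] through [g x], [e] and
   [p e] to [mu (p e)]. *)
have conj : (rho * circuit gK qK wg wq * rho^-1 =
    circuit gK pK og op * (pp * (mu_ false)^-1 * pp) * mu_ true)%g.
  apply/permP => x; rewrite !permM [circuit _ _ _ _ _]permE.
  rewrite [circuit _ _ _ _ x]permE /circuit_fun w_rho.
  have fixmu b z : o z != b -> (mu_ b) z = z by move=> /negbTE oz; rewrite permE oz.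
  case ox: (o x); last first.
    have -> : pp x = p x by rewrite permE.
    have mu_px : mu_ false (p x) = p x by rewrite fixmu // op ox.
    by rewrite permK -mu_px permK [pp _]permE pK fixmu ?ox.
  have [e eE] : exists e, g x = mu e by exists (mu^-1 (g x))%g; rewrite permKV.
  have oe : o e = false by rewrite -o_mu -eE og ox.
  have -> : pp (p (g x)) = mu_ false e by rewrite permE pK eE permE oe.
  rewrite permK [pp e]permE [mu_ true _]permE op oe /=.
  by apply: (@perm_inj _ rho); rewrite permKV rho_mu lam_p -rho_mu -eE rho_g.
have := congr1 (@odd_perm T) conj.
rewrite !odd_permM !odd_permV.
have := congr1 (@odd_perm T) muE; rewrite mu_def !odd_permM odd_permV.
by do 7!case: (odd_perm _).
Qed.

(* [q \o g] never maps an element into the orbit of its [g]-partner: half-way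
   along such an orbit [g] or [q] would have a fixed point. *)
Lemma bipartite_exists (T : finType) (g q : T -> T) :
    involutive g -> involutive q -> (forall x, g x != x) -> (forall x, q x != x) ->
  exists w : pred T, (forall x, w (g x) = ~~ w x) /\ (forall x, w (q x) = ~~ w x).
Proof.
move=> gK qK gN qN; pose f := q \o g.
have f_inj : injective f by apply: inj_comp; apply: inv_inj.
have f_sym := fconnect_sym f_inj.
(* [g] conjugates [f] to its inverse [g \o q]. *)
have gf k x : g (iter k f x) = iter k (g \o q) (g x).
  by elim: k => //= k <-.
have fgq k : cancel (iter k (g \o q)) (iter k f).
  by elim: k => // k IHk x; rewrite iterSr [iter k.+1 _ x]/= /f /= gK qK IHk.
have gqf k : cancel (iter k f) (iter k (g \o q)).
  by elim: k => // k IHk x; rewrite iterSr [iter k.+1 _ x]/= /f /= qK gK IHk.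
have disj x : ~~ fconnect f x (g x).
  apply/negP => /iter_findex; move: (findex _ _ _) => k.
  rewrite -[k]odd_double_half -addnn addnCA iterD.
  move: (odd _) (k./2) => b m /(congr1 (iter m (g \o q))); rewrite gqf -gf.
  case: b => /= E; last by case/eqP: (gN (iter m f x)).
  by case/eqP: (qN (g (iter m f x))).
pose e : rel T := fun x y => (y == g x) || (y == q x).
have e_sym : connect_sym e by apply: involutive_connect_sym.
have g_conn x y : fconnect f x y -> fconnect f (g x) (g y).
  by move/iter_findex => <-; rewrite f_sym gf -{2}(fgq (findex f x y) (g x)) fconnect_iter.
have comp r x : connect e r x -> fconnect f r x || fconnect f (g r) x.
  pose h y := fconnect f r y || fconnect f (g r) y.
  move=> rx; rewrite -/(h x); suff <- : h r = h x by rewrite /h connect0.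
    apply: connect_invariant rx => {}x y; rewrite /h.
    have gx : fconnect f r (g x) = fconnect f (g r) x.
      by apply/idP/idP => /g_conn; rewrite gK.
    have ggx : fconnect f (g r) (g x) = fconnect f r x.
      by apply/idP/idP => /g_conn; rewrite ?gK.
    case/orP => /eqP ->; first by rewrite gx ggx orbC.
    have -> : q x = f (g x) by rewrite /f /= gK.
    by rewrite -!(same_fconnect1_r f_inj) gx ggx orbC.
(* Each component is the union of the two disjoint [f]-orbits of its root [r] and of [g r]; [w]
   selects the first. *)
pose w x := fconnect f (fingraph.root e x) x.
have wg x : w (g x) = ~~ w x.
  rewrite /w; have -> : fingraph.root e (g x) = fingraph.root e x.
    by apply/esym/(fingraph.rootP e_sym)/connect1; rewrite /e eqxx.
  have rx : connect e (fingraph.root e x) x by rewrite e_sym connect_root.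
  move: (fingraph.root e x) rx => r /comp; case rx: (fconnect f r x) => /=.
    move=> _; apply/negP; move/(connect_trans _); rewrite f_sym in rx.
    by move/(_ _ rx); apply/negP.
  by move/g_conn; rewrite gK.
exists w; split=> // x; rewrite -wg /w.
have -> : fingraph.root e (q x) = fingraph.root e (g x).
  apply/(fingraph.rootP e_sym); apply: (@connect_trans _ _ x); apply: connect1.
    by rewrite /e qK eqxx orbT.
  by rewrite /e eqxx.
apply: same_connect_r => //.
rewrite f_sym -{2}[x]gK; exact: fconnect1.
Qed.

(** * Planar diagrams: mod 2 cycles bound *)

Section Planar.
Variable D : diagram.
Hypothesis wfD : wf_diagram D.
Notation n := (nv D).
Notation dart := (dart n).

Let glueK : involutive (glue D). Proof. by case: wfD. Qed.
Let outd_glue d : outd D (glue D d) = ~~ outd D d. Proof. by case: wfD. Qed.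

Lemma drot_inj : injective (@drot n).
Proof.
move=> [u i] [v j] E; have /= -> := congr1 fst E.
by have /= /addIr -> := congr1 snd E.
Qed.

Lemma doppK : involutive (@dopp n).
Proof.
by move=> [v j]; congr (_, _); case: j => [[|[|[|[]]]] ?] //; apply: val_inj.
Qed.

Lemma sum_dart (R : nmodType) (F : dart -> R) : \sum_d F d = \sum_v (\sum_j F (v, j)).
Proof. by rewrite pair_bigA /=; apply: eq_bigr => -[]. Qed.

Lemma sum_vertex (R : nmodType) (F : dart -> R) v : let d := (v, 0) in
  \sum_j F (v, j) = F d + F (drot d) + F (drot (drot d)) + F (drot (drot (drot d))).
Proof.
rewrite !big_ord_recl big_ord0 /= addr0 -!addrA.
by do !congr (_ + _); congr F; congr (_, _); apply: val_inj.
Qed.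

Lemma card_alternating (c : pred dart) :
  (forall d, c (glue D d) = ~~ c d) -> #|c| = (2 * n)%N.
Proof.
move=> cg; have := cardC c.
rewrite [X in (_ + X)%N](card_flip glueK cg) addnn -mul2n card_prod !card_ord => h.
by apply/eqP; rewrite -(eqn_pmul2l (isT : (0 < 2)%N)) h mulnA mulnC.
Qed.

(** * Mod 2 chains of the cellular surface and their dimensions *)

Local Notation B := (bool : fieldType).
Local Notation W := {ffun dart -> B^o}.

(** This operator has two uses: its kernel consists of the [g]-invariant functions, and for
    [g = glue D] it sends a face colouring to the edges where the colour changes. *)
Let pullback (g : dart -> dart) (f : W) : W := [ffun d => f d - f (g d)].
Let pullback_lin g : linear (pullback g).
Proof. by move=> a u v; apply/ffunP=> d; rewrite !ffunE scalerBr opprD addrACA. Qed.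
Let pl g : {linear W -> W} :=
  HB.pack (pullback g) (GRing.isLinear.Build _ _ _ _ _ (pullback_lin g)).
Let inv g : {vspace W} := lker (linfun (pl g)).

Let invP g (f : W) : reflect (forall d, f (g d) = f d) (f \in inv g).
Proof.
rewrite memv_ker lfunE /=; apply: (iffP eqP) => [/ffunP H d|H].
  by have := H d; rewrite !ffunE => /eqP; rewrite subr_eq0 => /eqP.
by apply/ffunP => d; rewrite !ffunE H subrr.
Qed.

Let bd (f : W) : {ffun 'I_n -> B^o} := [ffun v => \sum_j f (v, j)].
Let bd_lin : linear bd.
Proof.
move=> a u v; apply/ffunP=> x; rewrite !ffunE scaler_sumr -big_split.
by apply: eq_bigr => j _; rewrite !ffunE.
Qed.
Let bdl : {linear W -> {ffun 'I_n -> B^o}} :=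
  HB.pack bd (GRing.isLinear.Build _ _ _ _ _ bd_lin).

Let graphrel : rel dart := fun x y => (y == drot x) || (y == glue D x).

Lemma drot4 (d : dart) : drot (drot (drot (drot d))) = d.
Proof.
by case: d => v j; congr (_, _); case: j => [[|[|[|[]]]] ?] //; apply: val_inj.
Qed.

Lemma graphrel_sym : connect_sym graphrel.
Proof.
have H x y : graphrel x y -> connect graphrel y x.
  have r z : connect graphrel z (drot z) by apply: connect1; rewrite /graphrel eqxx.
  case/orP=> /eqP ->.
    rewrite -{2}(drot4 x); apply: connect_trans (r _) _.
    by apply: connect_trans (r _) _; apply: r.
  by apply: connect1; rewrite /graphrel glueK eqxx orbT.
have H2 x y : connect graphrel x y -> connect graphrel y x.
  case/connectP=> p; elim: p x => [|z p IHp] x /=; first by move=> _ ->.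
  by case/andP => /H xz /IHp h /h zy; apply: connect_trans zy xz.
by move=> x y; apply/idP/idP; apply: H2.
Qed.

(** 2-chains are functions constant around faces; 1-cycles are [glue]-invariant functions with even
    sum at each vertex. *)
Let Fc := inv (fun d => drot (glue D d)).
Let Z := (inv (glue D) :&: lker (linfun bdl))%VS.

Let dimFc : \dim Fc = nfaces D.
Proof.
apply: dim_invariants.
  by apply: fconnect_sym => x y /drot_inj /(inv_inj glueK).
move=> f; apply: (iffP (invP _ _)) => [H x y /eqP <-|H d]; first by rewrite H.
by rewrite -(H d) //= eqxx.
Qed.

(** A face colouring that changes across no edge is invariant under [glue D] and hence under
    rotation, so it is constant on graph components. *)
Let dimker : (\dim (Fc :&: lker (linfun (pl (glue D)))) <= ngraphcomp D)%N.
Proof.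
have <- : \dim (inv (glue D) :&: inv (@drot n)) = ngraphcomp D.
  apply: dim_invariants graphrel_sym _ => f; rewrite memv_cap.
  apply: (iffP andP) => [[/invP H1 /invP H2] x y|H].
    by case/orP => /eqP ->; rewrite ?H1 ?H2.
  by split; apply/invP => d; symmetry; apply: H; rewrite /graphrel eqxx ?orbT.
apply: dimvS; apply/subvP => f; rewrite !memv_cap => /andP[/invP fF fg].
rewrite [f \in _]fg; apply/invP => d; rewrite -(invP _ _ fg d).
by rewrite -[in LHS](glueK d) fF.
Qed.

Let dimWg : \dim (inv (glue D)) = (2 * n)%N.
Proof.
have sym : connect_sym (frel (glue D)) by apply: fconnect_sym; apply: inv_inj.
rewrite (dim_invariants sym).
  pose cls d := if outd D d then d else glue D d.
  rewrite (@n_comp_image _ _ _ _ cls) //.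
    rewrite -(card_alternating (c := [pred d | outd D d]) outd_glue).
    apply: eq_card => d; rewrite !inE.
    apply/imsetP/idP => [[x _ ->]|od].
      by rewrite /cls; case: ifP => // /negbT; rewrite -outd_glue.
    by exists d => //; rewrite /cls od.
  move=> x y _ _.
  have cE z : connect (frel (glue D)) z (cls z).
    by rewrite /cls; case: ifP => // _; exact: fconnect1.
  apply/eqP/idP => [exy|].
    by apply: connect_trans (cE x) _; rewrite exy sym.
  apply: connect_invariant => {x y} x _ /eqP <-.
  by rewrite /cls outd_glue; case: (outd D x); rewrite //= ?glueK.
move=> f; apply: (iffP (invP _ _)) => [H x y /eqP <-|H d]; first by rewrite H.
by rewrite -(H d) //= eqxx.
Qed.

(* Modulo boundaries each vertex equals the root of its component. *)
Let rank_bd : (n <= \dim (linfun bdl @: inv (glue D)) + ngraphcomp D)%N.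
Proof.
pose E v : {ffun 'I_n -> B^o} := [ffun u => u == v].
pose rt v := (fingraph.root graphrel (v, 0)).1.
pose R := [seq E d.1 | d <- enum (roots graphrel)].
pose V' := (linfun bdl @: inv (glue D))%VS.
have step x y : graphrel x y -> E x.1 - E y.1 \in V'.
  case/orP=> /eqP ->; first by rewrite subrr mem0v.
  have -> : E x.1 - E (glue D x).1 = linfun bdl [ffun d => (d == x) || (d == glue D x)].
    apply/ffunP => u; rewrite lfunE /= !ffunE.
    under eq_bigr do rewrite ffunE.
    have aux (z : dart) : (u == z.1) = \sum_j ((u, j) == z) :> bool.
      case: z => v j /=; rewrite (bigD1 j) //= xpair_eqE eqxx andbT big1 ?addr0 //.
      by move=> k /negbTE kj; rewrite xpair_eqE kj andbF.
    rewrite !aux -sumrB; apply: eq_bigr => j _.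
    case: eqP => [->|_]; case: eqP => //.
    by case: wfD => _ /(_ x)/eqP h _ _ _ /esym.
  apply: memv_img; apply/invP => d; rewrite !ffunE (inv_eq glueK) (inj_eq (inv_inj glueK)).
  by rewrite orbC.
have conn x y : connect graphrel x y -> E x.1 - E y.1 \in V'.
  case/connectP=> p; elim: p x => [|z p IHp] x /=; first by move=> _ ->; rewrite subrr mem0v.
  case/andP => /step xz /IHp h /h zy; have := memvD xz zy.
  by rewrite addrA subrK.
have full : (fullv <= V' + <<R>>)%VS.
  apply/subvP => f _.
  have -> : f = \sum_v f v *: E v.
    apply/ffunP => u; rewrite sum_ffunE (bigD1 u) //= big1 ?addr0; last first.
      by move=> v /negbTE vu; rewrite !ffunE eq_sym vu; exact: mulr0.
    by rewrite !ffunE eqxx; symmetry; exact: mulr1.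
  apply: memv_suml => v _; apply: memvZ.
  rewrite -[E v](subrK (E (rt v))); apply: memv_add.
    by apply: (conn (v, 0)); apply: connect_root.
  apply: memv_span; apply/mapP; exists (fingraph.root graphrel (v, 0)) => //.
  by rewrite mem_enum; apply: roots_root graphrel_sym _.
have := leq_trans (dimvS full) (dimv_add_leqif _ _).1.
rewrite dimvf /dim /= muln1 card_ord => /leq_trans; apply.
rewrite leq_add2l; apply: leq_trans (dim_span _) _.
rewrite size_map -cardE /ngraphcomp /n_comp_mem.
by apply: subset_leq_card; apply/subsetP => x; rewrite !inE andbT.
Qed.

(* Genus 0 means H_1 = 0: mod 2 cycles are boundaries of face colourings. *)
Lemma cycle_is_boundary (T : dart -> bool) :
    (forall d, T (glue D d) = T d) -> (forall v, \sum_j T (v, j) = 0) ->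
  exists f : dart -> bool,
    (forall d, f (drot (glue D d)) = f d) /\ (forall d, T d = f d + f (drot d)).
Proof.
move=> Tg Tv.
pose Tf0 : W := [ffun d => T d].
have TZ : Tf0 \in Z.
  rewrite /Z memv_cap; apply/andP; split; first by apply/invP => d; rewrite !ffunE.
  rewrite memv_ker lfunE /=; apply/eqP/ffunP => v; rewrite !ffunE.
  by rewrite -[RHS](Tv v); apply: eq_bigr => j _; rewrite ffunE.
have Fsub : (linfun (pl (glue D)) @: Fc <= Z)%VS.
  apply/subvP => _ /memv_imgP[f /invP fF ->]; rewrite lfunE /=.
  have fr d : f (glue D d) = f (drot d) by rewrite -fF glueK.
  rewrite /Z memv_cap; apply/andP; split.
    by apply/invP => d; rewrite !ffunE glueK; exact: addbC.
  rewrite memv_ker lfunE /=; apply/eqP/ffunP => v; rewrite !ffunE.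
  under eq_bigr do rewrite ffunE fr.
  rewrite big_split /= sumrN /drot /=.
  rewrite [X in _ - X](_ : _ = \sum_j f (v, j)) ?subrr //.
  by symmetry; rewrite (reindex_inj (@addIr 'I_4 1)).
(* With C graph components, genus 0 gives [\dim Fc] = n + 2C, so the image has dimension at least n
   + C. The rank bound gives [\dim Z] at most 2n - (n - C) = n + C. *)
have /eqP imF : (linfun (pl (glue D)) @: Fc)%VS == Z.
  rewrite eqEdim Fsub andTb.
  have := limg_ker_dim (linfun (pl (glue D))) Fc; rewrite dimFc.
  have := limg_ker_dim (linfun bdl) (inv (glue D)); rewrite dimWg -/Z.
  have := dimker; have := rank_bd; have [_ _ _ _ ->] := wfD.
  move: (\dim Z) (\dim (_ @: Fc)) (\dim (Fc :&: _)) (\dim (_ @: inv _)).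
  by move: (ngraphcomp D) n; clear; lia.
move: TZ; rewrite -imF => /memv_imgP[f /invP fF]; rewrite lfunE /= => /ffunP Tf.
exists f; split=> // d; have := Tf d; rewrite !ffunE => ->.
by rewrite -(fF (glue D d)) glueK.
Qed.

(* The colour of the face along each half-edge outside T, summed over all
   half-edges, cancels along edges and counts 1 at each transversal crossing. *)
Lemma transversal_even (T : dart -> bool) :
    (forall d, T (glue D d) = T d) -> (forall v, \sum_j T (v, j) = 0) ->
  \sum_v (let d := (v, 0) in [&& T d (+) T (drot d), T d == T (drot (drot d))
                              & T (drot d) == T (drot (drot (drot d)))]) = 0.
Proof.
move=> Tg Tv; have [f [fF Tf]] := cycle_is_boundary Tg Tv.
have fg d : ~~ T d -> f (glue D d) = f d.
  by rewrite -(fF (glue D d)) glueK Tf; case: (f d); case: (f _).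
transitivity (\sum_d (~~ T d && f d)).
  rewrite sum_dart; apply: eq_bigr => v _.
  rewrite (sum_vertex (fun d => ~~ T d && f d)); move: (v, 0) => d /=; rewrite !Tf drot4.
  by case: (f d); case: (f (drot d)); case: (f (drot (drot d))); case: (f _).
rewrite (bigID (outd D)) /= [X in _ + X](_ : _ = \sum_(d | outd D d) (~~ T d && f d)).
  exact: addbb.
rewrite (reindex_inj (inv_inj glueK)) /=; apply: eq_big => d.
  by rewrite outd_glue negbK.
by rewrite Tg; case Td: (T d) => //= _; rewrite fg ?Td.
Qed.

End Planar.

(** * Counting state curves modulo 2 *)

(** The sum is taken in [bool] as the field with two elements, which lets parities be rearranged
    into sums over crossings. *)
Lemma odd_card_sum (T : finType) (P : pred T) : odd #|P| = \sum_x P x.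
Proof.
rewrite -sum1_card big_mkcond (big_morph odd oddD (erefl _)).
by apply: eq_bigr => x _; rewrite unfold_in; case: (P x).
Qed.

Section Resolution.
Variables (D : diagram) (s : state D).
Hypothesis wfD : wf_diagram D.
Notation n := (nv D).
Notation dart := (dart n).
Notation virt d := (is_virtual (xkind D d.1)).
Notation outd := (outd D).
Notation glue := (glue D).

Let glueK : involutive glue. Proof. by case: wfD. Qed.
Let glueN d : glue d != d. Proof. by case: wfD. Qed.
Let outd_glue d : outd (glue d) = ~~ outd d. Proof. by case: wfD. Qed.
Let outd_opp d : outd (dopp d) = ~~ outd d. Proof. by case: wfD. Qed.

Let oppE (d : dart) : dopp d = drot (drot d).
Proof. by []. Qed.

Let drotVE (d : dart) : drotV d = drot (drot (drot d)).
Proof. by rewrite -[d in LHS]drot4 /drotV /drot /= addrK. Qed.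

Let outd_rr d : outd (drot (drot d)) = ~~ outd d.
Proof. by rewrite -oppE outd_opp. Qed.

Let drot_fst (d : dart) : (drot d).1 = d.1. Proof. by []. Qed.

(** Once everything is a power of [drot], a local identity depends only on the crossing kind, its
    resolution and the directions of two adjacent half-edges; the opposite ones are reversed. *)
Let local := (oppE, drotVE, drot4, drot_fst, outd_rr).

Local Ltac local_cases d :=
  let vd := fresh in let sd := fresh in let od := fresh in let o1 := fresh in
  case vd: (virt d); case sd: (s d.1); case od: (outd d); case o1: (outd (drot d));
  do 4?rewrite /= ?(local, vd, sd, od, o1) ?eqxx.

Let drotN k (d : dart) : (0 < k < 4)%N -> iter k (@drot n) d != d.
Proof.
by case: d => v [[|[|[|[]]]] ?] //; case: k => [|[|[|[|]]]] //= _;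
  rewrite /drot /= xpair_eqE eqxx.
Qed.

Lemma partnerK : involutive (partner s).
Proof.
by move=> d; rewrite /partner !local; local_cases d.
Qed.

Lemma partner_neq d : partner s d != d.
Proof.
rewrite /partner !local; have := (drotN (k := 1) d isT, drotN (k := 2) d isT, drotN (k := 3) d isT).
move=> /= rN; case: ifP => _; rewrite ?rN //.
by case: (s d.1); case: (_ == outd d); rewrite rN.
Qed.

Lemma outd_partner d : outd (partner s d) = outd d (+) (virt d || s d.1).
Proof.
by rewrite /partner !local; local_cases d.
Qed.

(** Orient every curve of the state; the weight records where this orientation disagrees with that
    of the diagram. *)
Lemma weight_exists : exists tau, is_weight s tau.
Proof.
have [w [wg wq]] := bipartite_exists glueK partnerK glueN partner_neq.
exists [ffun d => w d (+) outd d]; apply/forallP => d; rewrite !ffunE wg wq.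
rewrite outd_glue outd_partner -negb_or.
by case: (w d); case: (outd d); case: (_ || _).
Qed.

(* Oriented resolution: exchanging the two incoming half-edges turns the
   pairing [dopp] into [partner s].  Disoriented resolution: exchanging an
   incoming half-edge with the outgoing one that follows it. *)
Definition swap_start (d : dart) := [&& ~~ virt d, ~~ outd d & outd (drot d) == ~~ s d.1].

Definition swap_fun d :=
  if swap_start d then drot d else if swap_start (drotV d) then drotV d else d.

Lemma swap_funK : involutive swap_fun.
Proof.
by move=> d; rewrite /swap_fun /swap_start !local; local_cases d.
Qed.

Definition swap : {perm dart} := perm (inv_inj swap_funK).

Lemma swap_partner d : swap (dopp d) = partner s (swap d).
Proof.
by rewrite !permE /swap_fun /swap_start /partner !local; local_cases d.
Qed.

Lemma odd_swap : odd_perm swap = \sum_d swap_start d.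
Proof.
rewrite (@odd_involution _ _ swap_start) => [|d|d].
- rewrite odd_card_sum; apply: eq_bigr => d _ /=.
  rewrite andbC; case fd: (swap_start d) => //=; rewrite permE /swap_fun fd.
  exact: (drotN (k := 1) d isT).
- by rewrite !permE swap_funK.
- by rewrite permE /swap_fun /swap_start !local; local_cases d.
Qed.

(** * The three signs attached to a weight map *)

Section Weight.
Variable tau : {ffun dart -> bool}.
Hypothesis tauP : is_weight s tau.

Let tau_glue d : tau (glue d) = tau d.
Proof. by have /forallP/(_ d)/andP[/eqP] := tauP. Qed.
Let tau_partner d : tau (partner s d) = tau d (+) (~~ virt d && ~~ s d.1).
Proof. by have /forallP/(_ d)/andP[_ /eqP] := tauP. Qed.

Let w d := tau d (+) outd d.
Let w_glue d : w (glue d) = ~~ w d.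
Proof. by rewrite /w tau_glue outd_glue addbN. Qed.
Let w_partner d : w (partner s d) = ~~ w d.
Proof.
rewrite /w tau_partner outd_partner -negb_or.
by case: (tau d); case: (outd d); case: orb.
Qed.

Let even_flip (c : pred dart) : (forall d, c (glue d) = ~~ c d) -> ~~ odd #|c|.
Proof.
by move=> /(card_alternating wfD) ->; rewrite mul2n odd_double.
Qed.

(** Reversing the edges of weight [true] carries [outd] to [w] and commutes with [glue]. *)
Let rho_fun d := if tau d then glue d else d.
Let rhoK : involutive rho_fun.
Proof.
by move=> d; rewrite /rho_fun; case td: (tau d); rewrite ?tau_glue td ?glueK.
Qed.
Let rho : {perm dart} := perm (inv_inj rhoK).

Let odd_rho : odd_perm rho = \sum_d (tau d && outd d).
Proof.
rewrite (@odd_involution _ _ outd) => [|d|d].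
- rewrite odd_card_sum; apply: eq_bigr => d _ /=; rewrite permE /rho_fun.
  by case: (tau d); rewrite ?glueN ?eqxx.
- by rewrite !permE rhoK.
- by rewrite permE /rho_fun; case: ifP; rewrite ?eqxx.
Qed.

(** [swap] transports [outd] to the orientation [w0] of the arcs inside the crossings. Reversing the
    arcs where [w0] and [w] differ completes a map carrying ([dopp], [outd]) to ([partner s],
    [w]). *)
Let w0 d := outd (swap d).
Let w0_partner d : w0 (partner s d) = ~~ w0 d.
Proof.
rewrite /w0; have swapK e : swap (swap e) = e.
  by rewrite ![swap _]permE; apply: swap_funK.
by rewrite -{1}(swapK d) -swap_partner swapK outd_opp.
Qed.

Let flip_fun d := if w d != w0 d then partner s d else d.
Let flip_partner d : flip_fun (partner s d) = partner s (flip_fun d).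
Proof.
rewrite /flip_fun w_partner w0_partner (inj_eq negb_inj).
by case: ifP.
Qed.
Let flipK : involutive flip_fun.
Proof.
move=> d; rewrite {2}/flip_fun; case: ifP => wd; last by rewrite /flip_fun wd.
by rewrite flip_partner /flip_fun wd partnerK.
Qed.
Let flip : {perm dart} := perm (inv_inj flipK).

Let odd_flip : odd_perm flip = \sum_d ((w d != w0 d) && w d).
Proof.
rewrite (@odd_involution _ _ w) => [|d|d].
- rewrite odd_card_sum; apply: eq_bigr => d _ /=; rewrite permE /flip_fun.
  by case: (w d != w0 d); rewrite ?partner_neq ?eqxx.
- by rewrite !permE flipK.
- by rewrite permE /flip_fun; case: ifP; rewrite ?eqxx.
Qed.

(** Components of [D] are circuits of [glue] and [dopp], curves of the state are circuits of [glue]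
    and [partner s]. The transport lemma compares their signs, and the free circles cancel. *)
Let curves_sign :
  odd (ncurves s) (+) odd (ncomponents D) = odd_perm rho (+) odd_perm swap (+) odd_perm flip.
Proof.
have nE : odd (n_comp (fun x y => (y == glue x) || (y == partner s x)) predT)
    = odd_perm (circuit glueK partnerK w_glue w_partner).
  by rewrite odd_circuit_connect // even_flip.
have kE : odd (n_comp (frel (@snext D)) [pred d | outd d])
    = odd_perm (circuit glueK (@doppK D) outd_glue outd_opp).
  by rewrite odd_circuit_fconnect // even_flip.
rewrite /ncurves /ncomponents !oddD nE kE.
rewrite (odd_circuit_transport (@doppK D) glueK partnerK outd_glue outd_opp w_glue w_partner
   (rho := rho) (lam := (swap * flip)%g)).
- by rewrite odd_permM; case: (odd (nfree D)); do 4!case: (odd_perm _).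
- by move=> d; rewrite !permE /rho_fun tau_glue; case: ifP.
- by move=> d; rewrite permE /rho_fun; case: ifP => td; rewrite ?w_glue /w td /= ?negbK.
- by move=> d; rewrite !permM [flip _]permE swap_partner flip_partner [flip _]permE.
- move=> d; have w0E : w0 (swap d) = outd d.
    by rewrite /w0 ![swap _]permE swap_funK.
  rewrite permM permE /flip_fun; case: ifP => [|/negbFE/eqP ->] //.
  by rewrite w_partner -w0E; case: (w _); case: (w0 _).
Qed.

(** All three signs are sums over half-edges. Grouped by crossing, they differ from the claimed
    terms by the indicator of a transversal crossing of the cycle [tau] with its complement, and
    these indicators sum to zero. *)
Lemma parity_key :
  odd (ncurves s) (+) odd (ncomponents D) =
  odd #|[pred v | ~~ is_virtual (xkind D v) && s v]|
  (+) odd #|[pred v | is_virtual (xkind D v) && (tau (v, 0) (+) tau (v, 1))]|.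
Proof.
(* The two arcs inside a crossing either both preserve or both switch the weight, so [tau] is a mod
   2 cycle. *)
have tau_even v : \sum_j tau (v, j) = 0.
  rewrite sum_vertex /=; move: (v, 0) => d.
  have := (tau_partner d, tau_partner (drot d), tau_partner (drot (drot d)),
           tau_partner (drot (drot (drot d)))).
  rewrite /partner !local.
  by local_cases d => [] [[[]]]; do 4!case: (tau _).
have := transversal_even wfD tau_glue tau_even.
rewrite curves_sign odd_rho odd_swap odd_flip !odd_card_sum => opp.
have key v : \sum_j (tau (v, j) && outd (v, j)) + \sum_j swap_start (v, j)
    + \sum_j ((w (v, j) != w0 (v, j)) && w (v, j))
    + (~~ is_virtual (xkind D v) && s v)
    + (is_virtual (xkind D v) && (tau (v, 0) (+) tau (v, 1))) =
    (let d := (v, 0) in [&& tau d (+) tau (drot d), tau d == tau (drot (drot d))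
                          & tau (drot d) == tau (drot (drot (drot d)))]).
  have -> : (v, 1) = drot (v, 0 : 'I_4) by rewrite /drot add0r.
  have -> : is_virtual (xkind D v) = virt (v, 0 : 'I_4) by [].
  have -> : s v = s (v, 0 : 'I_4).1 by [].
  rewrite (sum_vertex (fun d => tau d && outd d)) (sum_vertex swap_start).
  rewrite (sum_vertex (fun d => (w d != w0 d) && w d)).
  move: (v, 0) => d /=.
  have := (tau_partner d, tau_partner (drot d), tau_partner (drot (drot d)),
           tau_partner (drot (drot (drot d)))).
  rewrite /w /w0 /partner !permE /swap_fun /swap_start !local.
  by local_cases d => [] [[[]]]; do 4!case: (tau _).
move: opp; rewrite -(eq_bigr _ (fun v _ => key v)) !big_split /=.
rewrite -(sum_dart (fun d => tau d && outd d)) -(sum_dart swap_start).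
rewrite -(sum_dart (fun d => (w d != w0 d) && w d)).
move: (\sum_d _) (\sum_d _) (\sum_d _) (\sum_(v < n) _) (\sum_(v < n) _).
by do 5!case.
Qed.

End Weight.
End Resolution.

(** * Laurent polynomials in A^4 *)

Lemma scaled_fraction_add (F : fieldType) (r a b x y : F) : a != 0 -> b != 0 ->
  r * a^-1 * x + r * b^-1 * y = r * (a * b)^-1 * (x * b + y * a).
Proof. by move=> a0 b0; field; rewrite a0 b0. Qed.

Section Cosets.

Let A_neq0 : varA != 0. Proof. by rewrite tofrac_eq0 polyX_eq0. Qed.

Let tofrac_compXn k : FracField.tofrac ('X^k \Po 'X^4 : {poly int}) = varA ^+ (4 * k).
Proof. by rewrite comp_Xn_poly -exprM tofracXn. Qed.

Lemma coset_varA r : in_Z4_coset (varA ^ r) r.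
Proof. by exists 1, 0%N; rewrite muln0 expr0 invr1 comp_polyC tofrac1 !mulr1. Qed.

Lemma cosetM x y r r' : in_Z4_coset x r -> in_Z4_coset y r' -> in_Z4_coset (x * y) (r + r').
Proof.
move=> [p [m ->]] [q [k ->]]; exists (p * q), (m + k)%N.
rewrite comp_polyM tofracM expfzDr // mulnDr exprD invfM.
by rewrite mulrACA [_ * _ * (varA ^ _ * _)]mulrACA.
Qed.

Lemma cosetX x r n : in_Z4_coset x r -> in_Z4_coset (x ^+ n) (r * n%:Z).
Proof.
move=> xr; elim: n => [|n IHn]; first by rewrite mulr0; exact: (coset_varA 0).
by rewrite exprS intS mulrDr mulr1; apply: cosetM.
Qed.

Lemma cosetD x y r : in_Z4_coset x r -> in_Z4_coset y r -> in_Z4_coset (x + y) r.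
Proof.
move=> [p [m ->]] [q [k ->]]; exists (p * 'X^k + q * 'X^m), (m + k)%N.
rewrite comp_polyD !comp_polyM tofracD !tofracM !tofrac_compXn mulnDr exprD.
by apply: scaled_fraction_add; apply: expf_neq0.
Qed.

Lemma coset_sum (I : Type) (l : seq I) (P : pred I) (F : I -> LK) r :
  (forall i, P i -> in_Z4_coset (F i) r) -> in_Z4_coset (\sum_(i <- l | P i) F i) r.
Proof.
move=> Fr; elim/big_ind: _ => //; last by move=> x y; apply: cosetD.
by exists 0, 0%N; rewrite comp_poly0 tofrac0 mulr0.
Qed.

(** Only the exponent modulo 4 matters, because 1 lies in the coset of every multiple of 4. *)
Lemma coset_shift x r (z : int) : in_Z4_coset x r -> in_Z4_coset x (r + 4 * z).
Proof.
suff one : in_Z4_coset 1 (4 * z).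
  by move=> xr; rewrite -[x]mulr1; apply: cosetM.
case: z => k.
  exists 1, k; rewrite comp_polyC tofrac1 mulr1 exprnN -expfzDr //.
  by rewrite PoszM subrr expr0z.
exists 'X^(k.+1), 0%N; rewrite tofrac_compXn muln0 expr0 invr1 mulr1.
by rewrite NegzE -[varA ^+ _]/(varA ^ Posz _) -expfzDr // PoszM mulrN addNr expr0z.
Qed.

Lemma cosetN x r : in_Z4_coset x r -> in_Z4_coset (- x) r.
Proof.
move=> [p [m ->]]; exists (- p), m.
by rewrite raddfN tofracN mulrN.
Qed.

Variables (D : diagram) (s : state D).

(** Modulo 4 the exponents 2 and -2 agree, so each factor attached to a curve or an oriented
    singular crossing contributes 2; [4 * b_st s] and the [beta_st] factors contribute 0. *)
Lemma coset_Rbar :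
  in_Z4_coset (Rbar s) (2 * (a_st s + (alpha_st s)%:Z + (ncurves s)%:Z)).
Proof.
have A2 : in_Z4_coset (- varA ^+ 2 - varA ^- 2) 2.
  apply: cosetD; first exact/cosetN/(coset_varA 2).
  by rewrite exprnN; apply/cosetN/(coset_shift 1 (coset_varA (- 2))).
have A4 : in_Z4_coset (- varA ^+ 4 - varA ^- 4) 0.
  apply: cosetD; first exact/cosetN/(coset_shift (- 1) (coset_varA 4)).
  by rewrite exprnN; apply/cosetN/(coset_shift 1 (coset_varA (- 4))).
have := cosetM (cosetM (coset_varA (2 * a_st s + 4 * b_st s))
  (cosetX (alpha_st s + ncurves s) A2)) (cosetX (beta_st s) A4).
move/(coset_shift (- b_st s)); rewrite /Rbar mul0r addr0 PoszD.
by congr in_Z4_coset; ring.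
Qed.

End Cosets.

(** * From the parity congruence to exponents modulo 4 *)

Lemma ival_parity (D : diagram) (tau : {ffun dart (nv D) -> bool}) :
  ival tau = (-1) ^+ #|[pred v | is_virtual (xkind D v) && (tau (v, 0) (+) tau (v, 1))]|.
Proof.
rewrite -prodr_const /ival big_mkcond [RHS]big_mkcond; apply: eq_bigr => v _.
by rewrite !inE; case: is_virtual => //=; case: (tau _); case: (tau _).
Qed.

(** This shows that the number of oriented resolutions has the parity of [a_st s + alpha_st s], the
    quantity in the exponent of [Rbar s]. *)
Lemma card_nonvirtual (D : diagram) (s : state D) :
  #|[pred v | ~~ is_virtual (xkind D v) && s v]| =
  (#|[pred v | is_classical_sign false (xkind D v) && s v]|
   + #|[pred v | is_classical_sign true (xkind D v) && s v]| + alpha_st s)%N.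
Proof.
have card_sum (P : pred 'I_(nv D)) : #|P| = (\sum_v P v)%N.
  by rewrite -sum1_card big_mkcond; apply: eq_bigr => v _; rewrite unfold_in; case: (P v).
rewrite /alpha_st !card_sum -!big_split; apply: eq_bigr => v _ /=.
by case: (xkind D v) => [[]||]; case: (s v).
Qed.

(** A weight map always exists, so the default value of [iS] never occurs; [parity_key] applies to
    whichever weight map is picked. *)
Lemma iS_parity (D : diagram) (s : state D) : wf_diagram D ->
  iS s = (-1) ^+ (odd (ncurves s) (+) odd (ncomponents D)
                 (+) odd #|[pred v | ~~ is_virtual (xkind D v) && s v]|).
Proof.
move=> wfD; rewrite /iS; case: pickP => [tau tauP|no_tau]; last first.
  by have [tau] := weight_exists s wfD; rewrite no_tau.
rewrite (parity_key wfD tauP) addbAC addbb.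
by rewrite ival_parity signr_odd.
Qed.

Lemma Rbar_coset_iS (D : diagram) (s : state D) : wf_diagram D ->
  in_Z4_coset (Rbar s) (2 * (ncomponents D)%:Z - (if iS s == 1 then 0 else 2)).
Proof.
move=> wfD; rewrite (iS_parity s wfD) card_nonvirtual.
have := coset_Rbar s; rewrite /a_st.
set a := #|[pred v | is_classical_sign false _ && _]|.
set b := #|[pred v | is_classical_sign true _ && _]|.
move: (Rbar s) a b (alpha_st s) (ncurves s) (ncomponents D) => x {}a {}b c d k xr.
rewrite !oddD.
suff [z <-] : exists z : int, 2 * (a%:Z - b%:Z + c%:Z + d%:Z) + 4 * z =
    2 * k%:Z - (if (-1) ^+ (odd d (+) odd k (+) (odd a (+) odd b (+) odd c))
                     == 1 :> int then 0 else 2).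
  exact: coset_shift.
(* The halves contribute multiples of 4 to the exponent, which leaves the 32 combinations of
   parities. *)
have half i : (i%:Z = (odd i)%:Z + 2 * i./2%:Z) by rewrite -PoszM mul2n -PoszD odd_double_half.
rewrite (half a) (half b) (half c) (half d) (half k).
move: (odd a) (odd b) (odd c) (odd d) (odd k) a./2 b./2 c./2 d./2 k./2.
move=> pa pb pc pd pk {xr}{}a {}b {}c {}d {}k.
pose e : int := 2 * ((pk : nat)%:Z - (pa : nat)%:Z + (pb : nat)%:Z - (pc : nat)%:Z - (pd : nat)%:Z)
  - (if (-1) ^+ (pd (+) pk (+) (pa (+) pb (+) pc)) == 1 :> int then 0 else 2).
suff [z ez] : exists z, 4 * z = e.
  exists (k%:Z - a%:Z + b%:Z - c%:Z - d%:Z + z); move: ez; rewrite /e.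
  by move: (if _ then _ else _) => t; clear; lia.
by rewrite {}/e; case: pa; case: pb; case: pc; case: pd; case: pk; 
  (try by exists 0); (try by exists 1); (try by exists (-1)); (try by exists (- 2)).
Qed.

Theorem theorem4p1 (D : diagram) :
  wf_diagram D ->
  Rpoly D = (phi D)%:P * 'X + (psi D)%:P /\
  in_Z4_coset (phi D) (2 * (ncomponents D)%:Z - 2) /\
  in_Z4_coset (psi D) (2 * (ncomponents D)%:Z).
Proof.
move=> wfD.
have sign_coset x r : in_Z4_coset x r -> in_Z4_coset ((-1) ^+ ncl D * x) r.
  by rewrite -signr_odd; case: odd; rewrite ?mul1r // mulN1r; apply: cosetN.
split; last split; first 1 last.
- apply/sign_coset/coset_sum => s /andP[_ /eqP iSE].
  by have := Rbar_coset_iS s wfD; rewrite iSE.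
- apply/sign_coset/coset_sum => s /andP[_ /eqP iSE].
  by have := Rbar_coset_iS s wfD; rewrite iSE subr0.
(* Since [iS] takes only the values 1 and -1, the states carrying ['X] are exactly those summed in
   [phi]. *)
have iS_sign (s : state D) : (iS s == -1) = (iS s != 1).
  by rewrite iS_parity //; case: (_ (+) _).
rewrite /Rpoly /phi /psi (bigID (fun s => iS s == 1)) /= addrC scalerDr.
rewrite -!mul_polyC !polyCM !rmorph_sum -mulrA mulr_suml /=.
congr (_ * _ + _ * _); apply: eq_big => s.
- by rewrite iS_sign.
- by move=> /andP[_ /negbTE ->]; rewrite expr1 mul_polyC.
- by [].
- by move=> /andP[_ ->]; rewrite expr0 alg_polyC.
Qed.
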